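(* Let $P\in\mathbb{H}[q_1,\ldots,q_n]$ be a regular polynomial in $n$ variables, let $1\le m\le n$ and let $a\in\mathbb{H}$. Then $P$ vanishes on $\mathbb{H}^{m-1}\times\{a\}\times(C_a)^{n-m}$ if and only if there exists $P_m\in\mathbb{H}[q_1,\ldots,q_n]$ such that $$P(q_1,\ldots,q_n)=(q_m-a)*P_m(q_1,\ldots,q_n).$$
   Context: $\mathbb{H}$ denotes the skew field of quaternions, and $C_a=\{q\in\mathbb{H} : aq=qa\}$ for $a\in\mathbb{H}$. $\mathbb{H}[q_1,\ldots,q_n]$ is the set of (slice) regular polynomials in $n$ quaternionic variables, i.e. functions $P:\mathbb{H}^n\to\mathbb{H}$ of the form $P(q_1,\ldots,q_n)=\sum q_1^{\ell_1}\cdots q_n^{\ell_n}a_{\ell_1,\ldots,\ell_n}$ (finite sum, coefficients in $\mathbb{H}$ on the right, evaluated in exactly this order at arbitrary points of $\mathbb{H}^n$). The $*$-product is the biadditive extension of $(q_1^{\ell_1}\cdots q_n^{\ell_n}a)*(q_1^{k_1}\cdots q_n^{k_n}b)=q_1^{\ell_1+k_1}\cdots q_n^{\ell_n+k_n}ab$; it makes $\mathbb{H}[q_1,\ldots,q_n]$ an associative ring. *)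

(* Defs.v *)
From HB Require Import structures.
From mathcomp Require Import all_boot all_order all_algebra ring lra.
From mathcomp Require Import reals.
From mathcomp Require Import mpoly.

Set Implicit Arguments.
Unset Strict Implicit.
Unset Printing Implicit Defensive.

Import Order.TTheory GRing.Theory Num.Theory.

Local Open Scope ring_scope.

Record quaternion (R : realType) := Quaternion {
  qre : R; qi : R; qj : R; qk : R
}.

Section Quaternion.
Variable R : realType.
Local Notation H := (quaternion R).
Implicit Types x y z : H.

Definition quat_to_tuple x := (qre x, qi x, qj x, qk x).
Definition tuple_to_quat (t : R * R * R * R) : H :=
  let: (a, b, c, d) := t in Quaternion a b c d.

Lemma quat_to_tupleK : cancel quat_to_tuple tuple_to_quat.
Proof. by case. Qed.

HB.instance Definition _ := Choice.copy H (can_type quat_to_tupleK).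

Definition quat_zero : H := Quaternion 0 0 0 0.
Definition quat_one : H := Quaternion 1 0 0 0.
Definition quat_opp x : H :=
  Quaternion (- qre x) (- qi x) (- qj x) (- qk x).
Definition quat_add x y : H :=
  Quaternion (qre x + qre y) (qi x + qi y) (qj x + qj y) (qk x + qk y).

(* i^2 = j^2 = k^2 = ijk = -1 *)
Definition quat_mul x y : H :=
  Quaternion
    (qre x * qre y - qi x * qi y - qj x * qj y - qk x * qk y)
    (qre x * qi y + qi x * qre y + qj x * qk y - qk x * qj y)
    (qre x * qj y - qi x * qk y + qj x * qre y + qk x * qi y)
    (qre x * qk y + qi x * qj y - qj x * qi y + qk x * qre y).

Definition quat_sqnorm x : R :=
  qre x ^+ 2 + qi x ^+ 2 + qj x ^+ 2 + qk x ^+ 2.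

Definition quat_inv x : H :=
  let d := (quat_sqnorm x)^-1 in
  Quaternion (qre x * d) (- qi x * d) (- qj x * d) (- qk x * d).

Lemma quat_addA : associative quat_add.
Proof. by move=> x y z; rewrite /quat_add /= !addrA. Qed.

Lemma quat_addC : commutative quat_add.
Proof. by move=> x y; congr Quaternion; rewrite addrC. Qed.

Lemma quat_add0 : left_id quat_zero quat_add.
Proof. by case=> a b c d; rewrite /quat_add /= !add0r. Qed.

Lemma quat_addN : left_inverse quat_zero quat_opp quat_add.
Proof. by case=> a b c d; rewrite /quat_add /= !addNr. Qed.

HB.instance Definition _ :=
  GRing.isZmodule.Build H quat_addA quat_addC quat_add0 quat_addN.

Lemma quat_mulA : associative quat_mul.
Proof. by move=> x y z; congr Quaternion => /=; ring. Qed.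

Lemma quat_mul1l : left_id quat_one quat_mul.
Proof. by case=> a b c d; congr Quaternion => /=; ring. Qed.

Lemma quat_mul1r : right_id quat_one quat_mul.
Proof. by case=> a b c d; congr Quaternion => /=; ring. Qed.

Lemma quat_mulDl : left_distributive quat_mul quat_add.
Proof. by move=> x y z; congr Quaternion => /=; ring. Qed.

Lemma quat_mulDr : right_distributive quat_mul quat_add.
Proof. by move=> x y z; congr Quaternion => /=; ring. Qed.

Lemma quat_oneN0 : quat_one != 0.
Proof. by apply/eqP => -[] /eqP; rewrite oner_eq0. Qed.

HB.instance Definition _ := GRing.Zmodule_isNzRing.Build H
  quat_mulA quat_mul1l quat_mul1r quat_mulDl quat_mulDr quat_oneN0.

Lemma quat_sqnorm_eq0 x : (quat_sqnorm x == 0) = (x == 0).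
Proof.
apply/eqP/eqP => [|->]; last by rewrite /quat_sqnorm /= expr0n /= !addr0.
case: x => a b c d; rewrite /quat_sqnorm /= => h.
have ha := sqr_ge0 a; have hb := sqr_ge0 b.
have hc := sqr_ge0 c; have hd := sqr_ge0 d.
have z (t : R) : 0 <= t ^+ 2 -> t ^+ 2 <= 0 -> t = 0.
  by move=> t0 t1; apply/eqP; rewrite -sqrf_eq0 eq_le t0 t1.
by congr Quaternion; apply: z => //; lra.
Qed.

Lemma quat_mulVx x : x != 0 -> quat_inv x * x = 1.
Proof.
rewrite -quat_sqnorm_eq0; case: x => a b c d; rewrite /quat_sqnorm /= => h.
by rewrite -[RHS]/quat_one; congr Quaternion => /=; rewrite /quat_sqnorm /=; field.
Qed.

Lemma quat_mulxV x : x != 0 -> x * quat_inv x = 1.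
Proof.
rewrite -quat_sqnorm_eq0; case: x => a b c d; rewrite /quat_sqnorm /= => h.
by rewrite -[RHS]/quat_one; congr Quaternion => /=; rewrite /quat_sqnorm /=; field.
Qed.

Lemma quat_unitP x y : y * x = 1 /\ x * y = 1 -> x != 0.
Proof.
case=> yx _; apply/eqP => x0; move: yx; rewrite x0 mulr0 => /eqP.
by rewrite eq_sym oner_eq0.
Qed.

Lemma quat_inv0 : {in [predC (fun x : H => x != 0)], quat_inv =1 id}.
Proof.
move=> x; rewrite inE negbK => /eqP ->.
by congr Quaternion => /=; rewrite ?oppr0 mul0r.
Qed.

HB.instance Definition _ := GRing.NzRing_hasMulInverse.Build H
  quat_mulVx quat_mulxV quat_unitP quat_inv0.

End Quaternion.

(* The variables of {mpoly (quaternion R)[n]} commute with each other and with *)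
(* the coefficients: identifying q^l a with the monomial of exponent l and     *)
(* coefficient a, its product is the *-product (see monomial_starM).           *)
(* rpeval is not multiplicative in p, and it is not mmap idfun, which puts the *)
(* coefficients on the left: here each monomial is q_1^l_1 ... q_n^l_n a, with *)
(* factors in this order (\prod_(i < n) is taken in increasing order of i).    *)
Definition rpeval (R : realType) (n : nat) (p : {mpoly (quaternion R)[n]})
    (q : 'I_n -> quaternion R) : quaternion R :=
  \sum_(l <- msupp p) (\prod_(i < n) q i ^+ l i) * p@_l.

Lemma monomial_starM (R : realType) (n : nat) (l k : 'X_{1..n})
    (a b : quaternion R) :
  (a *: 'X_[l]) * (b *: 'X_[k]) = (a * b) *: 'X_[l + k]
  :> {mpoly (quaternion R)[n]}.
Proof.
rewrite -!mul_mpolyC mpolyXD mpolyCM -!mulrA; congr (_ * _).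
by rewrite !mulrA -(commr_mpolyX l b%:MP).
Qed.

Lemma digits_inj (N n : nat) (f g : 'I_n -> nat) :
  (forall i, f i < N)%N -> (forall i, g i < N)%N ->
  (\sum_(i < n) f i * N ^ i = \sum_(i < n) g i * N ^ i)%N -> f =1 g.
Proof.
elim: n f g => [|n IHn] f g ltf ltg; first by move=> _ [].
rewrite !big_ord_recl /= !expn0 !muln1.
have E (h : 'I_n.+1 -> nat) :
  (\sum_(i < n) h (lift ord0 i) * N ^ bump 0 i =
   (\sum_(i < n) h (lift ord0 i) * N ^ i) * N)%N.
  by rewrite big_distrl; apply: eq_bigr => i _; rewrite /= expnSr mulnA.
rewrite !E => eqfg.
have eq0 : f ord0 = g ord0.
  have := congr1 (modn^~ N) eqfg.
  by rewrite ![(_ ord0 + _)%N]addnC !modnMDl !modn_small.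
have eqS : (fun i => f (lift ord0 i)) =1 (fun i => g (lift ord0 i)).
  apply: IHn => [i|i|]; [exact: ltf|exact: ltg|].
  have N0 : (0 < N)%N by apply: leq_ltn_trans (ltf ord0).
  move: eqfg; rewrite eq0 => /addnI /eqP; rewrite eqn_pmul2r // => /eqP.
  exact.
by move=> i; case: (unliftP ord0 i) => [j|] ->; [exact: eqS|exact: eq0].
Qed.

(* A polynomial is determined by its values on H^n, so equality in             *)
(* {mpoly (quaternion R)[n]} is equality of polynomial functions.              *)
Lemma rpeval_inj (R : realType) (n : nat) (p1 p2 : {mpoly (quaternion R)[n]}) :
  rpeval p1 =1 rpeval p2 -> p1 = p2.
Proof.
set H := quaternion R => eqp.
pose r (t : nat) : H := t%:R.
have rpR (p : {mpoly H[n]}) (q : 'I_n -> nat) :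
    rpeval p (fun i => r (q i)) = mmap idfun (fun i => r (q i)) p.
  rewrite /rpeval /mmap; apply: eq_bigr => l _; rewrite /mmap1 /=.
  under eq_bigr do rewrite /r -natrX.
  by rewrite -natr_prod commr_nat.
apply/eqP; rewrite -subr_eq0; set p := p1 - p2; apply/eqP.
have p0 q : mmap idfun (fun i => r (q i)) p = 0.
  by rewrite /p mmapB -!rpR eqp subrr.
apply/eqP; apply: contraT; rewrite -msupp_eq0 => supp_p.
have [m0 m0p] : exists m, m \in msupp p.
  by case: (msupp p) supp_p => // m s _; exists m; rewrite mem_head.
pose N := msize p.
pose K (m : 'X_{1..n}) := (\sum_(i < n) m i * N ^ i)%N.
have K_inj m m' : m \in msupp p -> m' \in msupp p -> K m = K m' -> m = m'.
  move=> mp mp' eqK; apply/mnmP.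
  have lt (u : 'X_{1..n}) : u \in msupp p -> forall i, (u i < N)%N.
    move=> up i; apply: leq_ltn_trans (msize_mdeg_lt up).
    by rewrite mdegE (bigD1 i) //= leq_addr.
  by apply: (digits_inj (N := N)) => //; exact: lt.
pose f : {poly H} := \sum_(m <- msupp p) p@_m *: 'X^(K m).
have fr t : root f (r t).
  apply/rootP; rewrite /f horner_sum -[RHS](p0 (fun i => t ^ N ^ i)%N) /mmap.
  apply: eq_bigr => m _; rewrite hornerZ hornerXn /mmap1 /=; congr (_ * _).
  rewrite /K /r -natrX expn_sum natr_prod; apply: eq_bigr => i _.
  by rewrite -natrX -expnM mulnC.
have f0 : f = 0.
  apply/eqP; apply: contraT => nzf.
  have := max_ring_poly_roots (rs := [seq r t | t <- iota 0 (size f)]) nzf.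
  rewrite size_map size_iota ltnn; apply.
    by apply/allP => x /mapP[t _ ->].
  have := iota_uniq 0 (size f); elim: iota => //= t s IHs /andP[ts us].
  rewrite IHs // andbT; apply/allP => x /mapP[u us' ->].
  rewrite /diff_roots commr_nat eqxx /=.
  have neq : u != t by apply: contraNneq ts => <-.
  rewrite unfold_in /=; apply: contraNneq neq => /eqP.
  rewrite subr_eq0 => /eqP e.
  have qre_nat k : qre (r k) = k%:R :> R.
    by elim: k => [|k IHk] //; rewrite /r !mulrS -IHk.
  by rewrite -(eqr_nat R) -!qre_nat e.
have := congr1 (fun g : {poly H} => g`_(K m0)) f0.
rewrite coef0 /f coef_sum (bigD1_seq m0) ?msupp_uniq //= big1_seq.
  rewrite addr0 coefZ coefXn eqxx mulr1 => /eqP.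
  by rewrite mcoeff_eq0 m0p.
move=> m /andP[neq mp]; rewrite coefZ coefXn.
case: eqP => [e|]; last by rewrite mulr0.
by rewrite (K_inj _ _ m0p mp e) eqxx in neq.
Qed.

(* Main.v *)
Require Import Defs.
From mathcomp Require Import all_boot all_order all_algebra.
From mathcomp Require Import reals ssrcomplements mpoly.

(** The ring {mpoly H[n]} carries the *-product, in which the variables are
central, so the informal statement is a remainder theorem for ordered
evaluation.

If P = (X_m - a) * Pm, it suffices to treat Pm = q^l b. There the product is
X_m q^l b - q^l a b, and the values of the two terms at a point with q_m = a
differ only in the place of one extra factor a: position m in the first term,
the far right of the powers in the second. When a commutes with every q_j,
j > m, that factor can be carried from one place to the other
([rpeval_XsubC_mul]).

Conversely, x^k - a^k is left divisible by x - a as soon as x and a commute,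
which X_m and a do in {mpoly H[n]}; hence P = (X_m - a) * Pm + S with S free
of X_m ([rem_XsubCP]). By the first part S vanishes wherever P was supposed to
vanish. Real numbers commute with a, so the points with q_m = a and all other
coordinates natural numbers are among these; since S ignores q_m, it then
vanishes at every point of N^n, and this forces S = 0 ([rpeval_nat_eq0]).

This last fact is proved by releasing the coordinates from N to H one at a
time, starting with the last one. While q_i is released the coordinates before
it are central, so the value has the form sum_l q_i^(l_i) c_l with all
coefficients on the right, and a one-variable polynomial of this kind over a
division ring of characteristic zero cannot vanish on N without vanishing
identically ([sum_expr_nat_eq0]). Releasing every coordinate gives a polynomial
that is zero on H^n, hence zero by [rpeval_inj]. *)

Set Implicit Arguments.
Unset Strict Implicit.
Unset Printing Implicit Defensive.

Import GRing.Theory.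
Local Open Scope ring_scope.

Lemma prod_ord_split (A : pzRingType) (n : nat) (m : 'I_n) (f : 'I_n -> A) :
  \prod_(i < n) f i =
  (\prod_(i < n | (i < m)%N) f i) * f m * \prod_(i < n | (m < i)%N) f i.
Proof.
elim: n => [|n IHn] in m f *; first by case: m.
rewrite [in RHS]big_mkcond [X in _ * X]big_mkcond /= !big_ord_recl.
case: (unliftP ord0 m) => [k|] -> /=.
  by rewrite (IHn k) mul1r -!big_mkcond !mulrA.
by rewrite big1_eq !mul1r.
Qed.

(** In a noncommutative ring a nonzero polynomial may have infinitely many roots;
the bound by the size survives for roots that commute pairwise with invertible
differences, as distinct natural numbers do here. *)
Lemma poly_nat_eq0 (A : unitRingType) (f : {poly A}) :
    (forall k, k.+1%:R \is a @GRing.unit A) ->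
  (forall t : nat, f.[t%:R] = 0) -> f = 0.
Proof.
move=> natU f0; apply/eqP; apply: contraT => nzf.
have := @max_ring_poly_roots _ f [seq t%:R | t <- iota 0 (size f)] nzf.
rewrite size_map size_iota ltnn; apply.
  by apply/allP => _ /mapP[t _ ->]; apply/rootP.
elim: (size f) 0%N => //= N IHN s; rewrite IHN andbT.
apply/allP => x /mapP[t]; rewrite mem_iota => /andP[lt_st _] ->.
rewrite /diff_roots commr_nat eqxx /= -natrB; last exact: ltnW.
by rewrite -(subnSK lt_st).
Qed.

Lemma converse_expr (A : pzRingType) (x : A) k : (x : A^c) ^+ k = (x ^+ k : A).
Proof. by elim: k => // k IHk; rewrite exprS IHk exprSr. Qed.

Lemma converse_nat (A : pzRingType) k : k%:R = (k%:R : A) :> A^c.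
Proof. by elim: k => // k IHk; rewrite !mulrS IHk. Qed.

(** Powers on the left, coefficients on the right: this is Horner evaluation of a
polynomial over the converse ring, which reduces the claim to
[poly_nat_eq0]. *)
Lemma sum_expr_nat_eq0 (A : unitRingType) (I : Type) (s : seq I)
    (e : I -> nat) (c : I -> A) :
    (forall k, k.+1%:R \is a @GRing.unit A) ->
    (forall t : nat, \sum_(l <- s) t%:R ^+ e l * c l = 0) ->
  forall x, \sum_(l <- s) x ^+ e l * c l = 0.
Proof.
move=> natU sum0 x.
pose f : {poly A^c} := \sum_(l <- s) (c l : A^c) *: 'X^(e l).
have fE (y : A) : f.[(y : A^c)] = \sum_(l <- s) y ^+ e l * c l.
  rewrite horner_sum; apply: eq_bigr => l _.
  by rewrite hornerZ hornerXn converse_expr.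
rewrite -fE (_ : f = 0) ?horner0 //.
apply: poly_nat_eq0 => [k|t]; first by rewrite converse_nat; exact: natU.
by rewrite converse_nat fE.
Qed.

Section RegularPolynomials.
Variables (R : realType) (n : nat).
Local Notation H := (quaternion R).
Implicit Types (p : {mpoly H[n]}) (q : 'I_n -> H) (l : 'X_{1..n}).

Lemma quat_natU k : k.+1%:R \is a @GRing.unit H.
Proof.
have qre_nat t : qre (t%:R : H) = t%:R.
  by elim: t => // t IHt; rewrite !mulrS -IHt.
rewrite unfold_in /=; apply: contraTneq isT => k0.
have := congr1 (@qre R) k0; rewrite qre_nat => /eqP.
by rewrite Num.Theory.pnatr_eq0.
Qed.

(** Additivity of evaluation needs a summation range common to several
polynomials, which the support is not. *)
Lemma rpevalwE q p k : (msize p <= k)%N ->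
  rpeval p q = \sum_(l : 'X_{1..n < k}) (\prod_(i < n) q i ^+ l i) * p@_l.
Proof.
move=> le_pk; pose I : subFinType _ := 'X_{1..n < k}.
rewrite /rpeval (big_mksub I) ?msupp_uniq //=; first last.
  by move=> l /msize_mdeg_lt /leq_trans; apply.
by rewrite big_rmcond //= => l /memN_msupp_eq0 ->; rewrite mulr0.
Qed.

Lemma rpevalD q : {morph @rpeval R n ^~ q : p1 p2 / p1 + p2}.
Proof.
move=> p1 p2; pose k := maxn (msize (p1 + p2)) (maxn (msize p1) (msize p2)).
rewrite !(@rpevalwE _ _ k) /k ?leq_max ?leqnn ?orbT // -big_split /=.
by apply: eq_bigr => l _; rewrite mcoeffD mulrDr.
Qed.

Lemma rpeval0 q : rpeval 0 q = 0.
Proof. by rewrite /rpeval msupp0 big_nil. Qed.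

Lemma rpeval_sum q (I : Type) (s : seq I) (F : I -> {mpoly H[n]}) :
  rpeval (\sum_(i <- s) F i) q = \sum_(i <- s) rpeval (F i) q.
Proof. exact: (big_morph _ (rpevalD q) (rpeval0 q)). Qed.

Lemma rpevalB q : {morph @rpeval R n ^~ q : p1 p2 / p1 - p2}.
Proof. by move=> p1 p2; apply: (addIr (rpeval p2 q)); rewrite -rpevalD !subrK. Qed.

Lemma rpeval_monomial q c l :
  rpeval (c *: 'X_[l]) q = (\prod_(i < n) q i ^+ l i) * c.
Proof.
rewrite /rpeval; have [->|c0] := eqVneq c 0.
  by rewrite scale0r msupp0 big_nil mulr0.
have -> : msupp (c *: 'X_[l]) = [:: l].
  apply/perm_small_eq => //; apply: uniq_perm => // u.
  rewrite mcoeff_msupp mcoeffZ mcoeffX inE (eq_sym u l).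
  by case: (l == u); rewrite ?mulr1 ?c0 ?mulr0 ?eqxx.
by rewrite big_seq1 mcoeffZ mcoeffX eqxx mulr1.
Qed.

(** The order of release matters: the coordinates before the released one must
still be natural numbers, hence central, for its power to come out on the
left of every term; those after it may already be arbitrary. *)
Lemma rpeval_nat_eq0 p :
  (forall t : 'I_n -> nat, rpeval p (fun i => (t i)%:R) = 0) -> p = 0.
Proof.
move=> p0; apply: rpeval_inj => q; rewrite rpeval0.
(* k counts the coordinates, taken from the end, that have been released. *)
suff free k q' : (forall i : 'I_n, (i < n - k)%N -> exists t, q' i = t%:R) ->
    rpeval p q' = 0.
  by apply: (free n) => i; rewrite subnn.
elim: k q' => [|k IHk] {}q natq.
  have /fin_all_exists[t qt] (i : 'I_n) : exists t, q i = t%:R.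
    by apply: natq; rewrite subn0.
  by rewrite -[RHS](p0 t) /rpeval; under eq_bigr do under eq_bigr do rewrite qt.
have [le_nk|lt_kn] := leqP n k.
  by apply: IHk => i; rewrite (eqP le_nk).
have lt_in : (n - k.+1 < n)%N by rewrite ltn_subrL /=; apply: leq_ltn_trans lt_kn.
pose i0 := Ordinal lt_in.
pose c l := (\prod_(i < n | (i < i0)%N) q i ^+ l i) *
  (\prod_(i < n | (i0 < i)%N) q i ^+ l i) * p@_l.
have evalE x : rpeval p [eta q with i0 |-> x] =
    \sum_(l <- msupp p) x ^+ l i0 * c l.
  apply: eq_bigr => l _; rewrite (prod_ord_split i0) /= eqxx /c !mulrA.
  congr (_ * _ * _); last first.
    by apply: eq_bigr => i; case: eqP => // ->; rewrite ltnn.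
  have -> : \prod_(i < n | (i < i0)%N) [eta q with i0 |-> x] i ^+ l i =
            \prod_(i < n | (i < i0)%N) q i ^+ l i.
    by apply: eq_bigr => i /=; case: eqP => // ->; rewrite ltnn.
  apply: commr_sym; apply: commr_prod => i lti; have [t ->] := natq i lti.
  by rewrite -natrX; apply: commr_nat.
(* q is kept as the point whose i0-th coordinate is varied. *)
have -> : rpeval p q = rpeval p [eta q with i0 |-> q i0].
  apply: eq_bigr => l _; congr (_ * _); apply: eq_bigr => i _ /=.
  by case: eqP => // ->.
rewrite evalE; apply: sum_expr_nat_eq0; first exact: quat_natU.
move=> t; rewrite -evalE; apply: IHk => i lti /=.
case: eqP => [_|/eqP ni]; first by exists t.
apply: natq; rewrite ltn_neqAle -ltnS subnSK //.
by apply/andP; split=> //; apply: contra ni => /eqP e; apply/eqP/val_inj.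
Qed.

(** Multiplying a monomial by X_m inserts the factor a in position m, multiplying
it by the constant a inserts a just before the coefficient; moving across the
powers of the later coordinates identifies the two values. *)
Lemma rpeval_XsubC_mul p (m : 'I_n) a q :
    q m = a -> (forall j : 'I_n, (m < j)%N -> a * q j = q j * a) ->
  rpeval (('X_m - a%:MP) * p) q = 0.
Proof.
move=> qm comq; rewrite (mpolyE p) mulr_sumr rpeval_sum big1_seq //= => l _.
rewrite mulrBl rpevalB mul_mpolyC scalerA -['X_m]scale1r monomial_starM.
rewrite !rpeval_monomial mul1r mulrA; apply/eqP; rewrite subr_eq0; apply/eqP.
congr (_ * _); rewrite !(prod_ord_split m) mnmDE mnm1E eqxx exprS qm.
have pre (P : pred 'I_n) : P m = false ->
    \prod_(i < n | P i) q i ^+ (U_(m) + l)%MM i = \prod_(i < n | P i) q i ^+ l i.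
  move=> Pm; apply: eq_bigr => i Pi; rewrite mnmDE mnm1E.
  by case: eqP => // mi; rewrite -mi Pm in Pi.
rewrite !pre ?ltnn // -exprS exprSr -!mulrA; congr (_ * (_ * _)).
by apply: commr_prod => j /comq; apply: commrX.
Qed.

Definition clear_exponent (m : 'I_n) l : 'X_{1..n} :=
  [multinom if i == m then 0%N else l i | i < n].

Lemma clear_exponentD (m : 'I_n) l : l = (U_(m) *+ l m + clear_exponent m l)%MM.
Proof.
apply/mnmP => i; rewrite mnmDE mulmnE mnm1E mnmE eq_sym.
by case: eqP => [->|_]; rewrite ?mul1n ?addn0.
Qed.

(** The remainder of the left division of [p] by X_m - a: the power of a stands on
the left of the coefficient, as in the product of the constant a^(l_m) with
the rest of the term. *)
Definition rem_XsubC (m : 'I_n) (a : H) p : {mpoly H[n]} :=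
  \sum_(l <- msupp p) (a ^+ l m * p@_l) *: 'X_[clear_exponent m l].

(** Termwise, X_m^k r - a^k r is left divisible by X_m - a because X_m and a
commute. *)
Lemma rem_XsubCP m a p : exists p' : {mpoly H[n]},
  p = ('X_m - a%:MP) * p' + rem_XsubC m a p.
Proof.
rewrite /rem_XsubC {1}(mpolyE p).
elim: (msupp p) => [|l s [p' IHs]].
  by exists 0; rewrite !big_nil mulr0 addr0.
rewrite !big_cons IHs.
have comXa : GRing.comm 'X_m a%:MP_[n] by apply/commr_sym/commr_mpolyX.
pose r : {mpoly H[n]} := p@_l *: 'X_[clear_exponent m l].
have -> : p@_l *: 'X_[l] = 'X_m ^+ l m * r :> {mpoly H[n]}.
  have -> : 'X_[l] = 'X_m ^+ l m * 'X_[clear_exponent m l] :> {mpoly H[n]}.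
    by rewrite mpolyXn -mpolyXD -clear_exponentD.
  by rewrite /r -!mul_mpolyC !mulrA mpolyXn (commr_mpolyX _ (p@_l)%:MP).
have -> : (a ^+ l m * p@_l) *: 'X_[clear_exponent m l] = a%:MP ^+ l m * r.
  by rewrite -rmorphXn mul_mpolyC scalerA.
exists ((\sum_(i < l m) 'X_m ^+ ((l m).-1 - i) * a%:MP ^+ i) * r + p').
rewrite mulrDr mulrA -(subrXX_comm _ comXa).
by rewrite [RHS]addrACA -mulrDl subrK.
Qed.

Lemma rpeval_rem_XsubC m a p q q' :
  (forall i, i != m -> q i = q' i) ->
  rpeval (rem_XsubC m a p) q = rpeval (rem_XsubC m a p) q'.
Proof.
move=> eqq; rewrite /rem_XsubC !rpeval_sum; apply: eq_bigr => l _.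
rewrite !rpeval_monomial; congr (_ * _); apply: eq_bigr => i _.
by rewrite mnmE; case: eqVneq => // /eqq ->.
Qed.

End RegularPolynomials.

Theorem proposition3p6 (R : realType) (n : nat)
    (P : {mpoly (quaternion R)[n]}) (m : 'I_n) (a : quaternion R) :
  (forall q : 'I_n -> quaternion R,
      q m = a ->
      (forall j : 'I_n, (m < j)%N -> a * q j = q j * a) ->
      rpeval P q = 0)
  <->
  (exists Pm : {mpoly (quaternion R)[n]}, P = ('X_m - a%:MP) * Pm).
Proof.
split=> [P0|[Pm ->] q qm comq]; last exact: rpeval_XsubC_mul.
have [Pm PE] := rem_XsubCP m a P; exists Pm.
suff rem0 : rem_XsubC m a P = 0 by rewrite {1}PE rem0 addr0.
apply: rpeval_nat_eq0 => t.
(* Replacing the m-th coordinate by a does not change the value of the remainder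
   and brings the point into the zero set of P. *)
pose q := [eta (fun i => (t i)%:R) with m |-> a] : 'I_n -> quaternion R.
have qm : q m = a by rewrite /q /= eqxx.
have comq (j : 'I_n) : (m < j)%N -> a * q j = q j * a.
  by rewrite /q /=; case: eqP => // _ _; apply: commr_nat.
have <- : rpeval (rem_XsubC m a P) q =
          rpeval (rem_XsubC m a P) (fun i => (t i)%:R).
  by apply: rpeval_rem_XsubC => i /negPf; rewrite /q /= => ->.
have := P0 q qm comq.
by rewrite {1}PE rpevalD rpeval_XsubC_mul // add0r.
Qed.
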